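(* If $T$ is a countable $\aleph_0$-categorical tree, then $T$ has only finitely many maximal chains up to isomorphism (as linear orders).
   Context: A tree is a partial order $(T,\leq)$ such that for all $x,y,z$, if $x,y\leq z$ then $x\leq y$ or $y\leq x$, and for all $x,y$ there is $z$ with $z\leq x,y$. A countable structure is $\aleph_0$-categorical if it is the unique countable model of its first-order theory (equivalently, its automorphism group has finitely many orbits on $n$-tuples for each $n$). *)

(* Defs.v *)
From HB Require Import structures.
From mathcomp Require Import all_boot all_order.
From mathcomp Require Import all_classical.

Set Implicit Arguments.
Unset Strict Implicit.
Unset Printing Implicit Defensive.

Import Order.TTheory.

Local Open Scope classical_set_scope.

(* First-order formulas with equality over one binary relation symbol, whose
   free variables (de Bruijn indices) range over 'I_n.  Equality, the relation
   symbol, falsity, implication and universal quantification are primitive. *)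
Inductive formula : nat -> Type :=
| FEq n of 'I_n & 'I_n : formula n
| FRel n of 'I_n & 'I_n : formula n
| FFalse n : formula n
| FImp n of formula n & formula n : formula n
| FAll n of formula n.+1 : formula n.

Fixpoint sat (M : Type) (r : M -> M -> Prop) (n : nat) (phi : formula n) :
    n.-tuple M -> Prop :=
  match phi in formula m return m.-tuple M -> Prop with
  | FEq _ i j => fun e => tnth e i = tnth e j
  | FRel _ i j => fun e => r (tnth e i) (tnth e j)
  | FFalse _ => fun _ => False
  | FImp _ p q => fun e => sat r p e -> sat r q e
  | FAll _ p => fun e => forall x : M, sat r p [tuple of x :: e]
  end.

Definition elementarily_equivalent (M N : Type)
    (r : M -> M -> Prop) (s : N -> N -> Prop) : Prop :=
  forall phi : formula 0, sat r phi [tuple] <-> sat s phi [tuple].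

Definition isomorphic (M N : Type)
    (r : M -> M -> Prop) (s : N -> N -> Prop) : Prop :=
  exists2 f : M -> N, bijective f & forall x y, r x y <-> s (f x) (f y).

(* Meant for countable [M].  "Countable" is "at most countable"; as finiteness
   and infinity are properties of the complete theory, this covers the usual
   convention for infinite structures and makes every finite one categorical. *)
Definition aleph0_categorical (M : Type) (r : M -> M -> Prop) : Prop :=
  forall (N : Type) (s : N -> N -> Prop), countable [set: N] ->
    elementarily_equivalent r s -> isomorphic r s.

Section Trees.
Context {d : Order.disp_t} (T : porderType d).

Definition is_tree : Prop :=
  (forall x y z : T, (x <= z)%O -> (y <= z)%O -> (x <= y)%O \/ (y <= x)%O) /\
  (forall x y : T, exists z : T, (z <= x)%O /\ (z <= y)%O).

Definition chain (C : set T) : Prop := total_on C (fun x y => (x <= y)%O).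

Definition maximal_chain (C : set T) : Prop :=
  chain C /\ forall D : set T, chain D -> C `<=` D -> D = C.

(* Order isomorphism of [C] and [D] with the induced orders; only the values
   of [f] on [C] matter. *)
Definition order_isomorphic (C D : set T) : Prop :=
  exists2 f : T -> T, set_bij C D f &
    forall x y, C x -> C y -> (x <= y)%O <-> (f x <= f y)%O.

End Trees.

(* Main.v *)
(* A maximal chain C is downward closed.  Either it has a greatest element m,
   and the orbit of m determines its order type; or, by a Ramsey argument, it
   has a cofinal sequence x_0 < x_1 < ... all of whose consecutive pairs lie in
   one orbit t of the automorphism group, and gluing automorphisms along the
   intervals (x_i, x_(i+1)] shows that t determines the order type of C.  So it
   is enough that there are finitely many orbits of pairs (Ryll-Nardzewski).
   For that, types are approximated by the back-and-forth relations of finite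
   rank, each of which has finite index.  Generic sequences of finite
   conditions produce countable structures elementarily equivalent to the given
   one, hence isomorphic to it.  If some type were not isolated by a finite
   rank, one such structure would omit it; and if no single rank isolated all
   types of n-tuples, Koenig's argument would give a non-isolated type, realized
   by another such structure. *)
Require Import Defs.
From mathcomp Require Import all_boot all_order.
From mathcomp Require Import all_classical.

Set Implicit Arguments.
Unset Strict Implicit.
Unset Printing Implicit Defensive.

Local Open Scope classical_set_scope.
Local Open Scope quotient_scope.

(** Pairing each point with its stage lets the invariant vary with the stage, so that stage [k] can
    settle the [k]-th of countably many tasks. *)
Lemma dependent_choice_inv (X : Type) (P : nat -> X -> Prop)
    (R : X -> X -> Prop) :
    (forall n x, P n x -> exists2 y, P n.+1 y & R x y) ->
  forall x0, P 0 x0 ->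
  exists2 f : nat -> X, f 0 = x0 & forall n, P n (f n) /\ R (f n) (f n.+1).
Proof.
move=> step x0 Px0.
pose S := {p : nat * X | P p.1 p.2}.
have next (u : S) :
    {v : S | (sval v).1 = (sval u).1.+1 /\ R (sval u).2 (sval v).2}.
  case: u => -[n x] /= Px; apply: cid.
  by have [y Py Rxy] := step _ _ Px; exists (exist _ (n.+1, y) Py).
have [f [f0 fS]] := dependent_choice next (exist _ (0, x0) Px0).
have f1 n : (sval (f n)).1 = n.
  by elim: n => [|n IHn]; [rewrite f0 | rewrite (fS n).1 IHn].
exists (fun n => (sval (f n)).2) => [|n]; first by rewrite f0.
by split; [have := svalP (f n); rewrite f1 | exact: (fS n).2].
Qed.

Lemma countable_enum (T : Type) (x0 : T) :
  countable [set: T] -> exists e : nat -> T, forall x, exists i, e i = x.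
Proof.
case/pfcard_geP => [T0|[e]]; first by suff: set0 x0 by []; rewrite -T0.
exists e => x; have [i _ <-] := 'surj_e (I : [set: T] x).
by exists i.
Qed.

(** * Back-and-forth relations of finite rank *)

(* Duplicator survives q rounds of the Ehrenfeucht-Fraisse game from the
   position in which the pairs in Z have already been played. *)
Fixpoint ef_equiv (M N : Type) (r : M -> M -> Prop) (s : N -> N -> Prop)
    (q : nat) (Z : set (M * N)) : Prop :=
  if q is q'.+1 then
    [/\ ef_equiv r s q' Z,
        forall x, exists y, ef_equiv r s q' (Z `|` [set (x, y)])
      & forall y, exists x, ef_equiv r s q' (Z `|` [set (x, y)])]
  else forall p p', Z p -> Z p' ->
    (p.1 = p'.1 <-> p.2 = p'.2) /\ (r p.1 p'.1 <-> s p.2 p'.2).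

Definition matching (M N : Type) (n : nat) (a : nat -> M) (b : nat -> N) :
  set (M * N) := [set p | exists2 i, i < n & p = (a i, b i)].

Section EhrenfeuchtFraisse.
Variables (M N : Type) (r : M -> M -> Prop) (s : N -> N -> Prop).

Lemma ef_sub q Z Z' : Z' `<=` Z -> ef_equiv r s q Z -> ef_equiv r s q Z'.
Proof.
elim: q Z Z' => [|q IHq] Z Z' sZ /=; first by move=> H p p' /sZ Zp /sZ; apply: H.
case=> H0 H1 H2; split=> [|x|y]; first exact: IHq H0.
- by have [y Hy] := H1 x; exists y; apply: IHq Hy; apply: setSU.
- by have [x Hx] := H2 y; exists x; apply: IHq Hx; apply: setSU.
Qed.

Lemma ef_le q q' Z : q <= q' -> ef_equiv r s q' Z -> ef_equiv r s q Z.
Proof.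
move=> /subnK <-; elim: (q' - q) => [//|k IHk].
by rewrite addSn => -[/IHk].
Qed.

Lemma ef_atom q Z p p' : ef_equiv r s q Z -> Z p -> Z p' ->
  (p.1 = p'.1 <-> p.2 = p'.2) /\ (r p.1 p'.1 <-> s p.2 p'.2).
Proof. by move=> /(ef_le (leq0n q)); apply. Qed.

End EhrenfeuchtFraisse.

Lemma ef_sym (M N : Type) (r : M -> M -> Prop) (s : N -> N -> Prop) q Z Z' :
    (forall p, Z' p -> Z (p.2, p.1)) ->
  ef_equiv r s q Z -> ef_equiv s r q Z'.
Proof.
elim: q Z Z' => [|q IHq] Z Z' /= sZ.
  move=> H p p' /sZ Zp /sZ Zp'; have /= [H1 H2] := H _ _ Zp Zp'.
  by split; apply: iff_sym.
case=> H0 H1 H2; split=> [|y|x]; first exact: IHq H0.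
- have [x Hx] := H2 y; exists x; apply: IHq Hx => p.
  by case=> [/sZ|->]; [left | right].
- have [y Hy] := H1 x; exists y; apply: IHq Hy => p.
  by case=> [/sZ|->]; [left | right].
Qed.

Lemma ef_trans (M N P : Type) (r : M -> M -> Prop) (s : N -> N -> Prop)
    (t : P -> P -> Prop) q (Z : set (M * N)) (Z' : set (N * P)) (Y : set (M * P)) :
    (forall p, Y p -> exists2 y, Z (p.1, y) & Z' (y, p.2)) ->
  ef_equiv r s q Z -> ef_equiv s t q Z' -> ef_equiv r t q Y.
Proof.
elim: q Z Z' Y => [|q IHq] Z Z' Y sY /=.
  move=> H H' p p' /sY[y Zy Z'y] /sY[y' Zy' Z'y'].
  have /= [-> ->] := H _ _ Zy Zy'; exact: (H' _ _ Z'y Z'y').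
case=> H0 H1 H2 [H0' H1' H2']; split=> [|x|z]; first exact: IHq H0 H0'.
- have [y Hy] := H1 x; have [z Hz] := H1' y; exists z; apply: IHq Hy Hz => p.
  case=> [/sY[y' Zy' Z'y']|->]; first by exists y'; left.
  by exists y; right.
- have [y Hy] := H2' z; have [x Hx] := H2 y; exists x; apply: IHq Hx Hy => p.
  case=> [/sY[y' Zy' Z'y']|->]; first by exists y'; left.
  by exists y; right.
Qed.

(** Of the [q + n] rounds, [n] are spent on the entries of [a] and [q] remain. *)
Lemma ef_extend (M N : Type) (r : M -> M -> Prop) (s : N -> N -> Prop) q n Z
    (a : nat -> M) : inhabited N -> ef_equiv r s (q + n) Z ->
  exists b : nat -> N, ef_equiv r s q (Z `|` matching n a b).
Proof.
move=> [y0]; elim: n q => [|n IHn] q; rewrite ?addn0 ?addnS => H.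
  by exists (fun=> y0); apply: ef_sub H => p [//|[]].
have {H} := H; rewrite -addSn => /IHn[b [_ /(_ (a n))[y Hy] _]].
exists (fun i => if i < n then b i else y); apply: ef_sub Hy => p.
case=> [Zp|[i]]; first by left; left.
rewrite ltnS leq_eqVlt => /orP[/eqP->|lt_in] ->.
  by right; rewrite ltnn.
by left; right; exists i; rewrite // lt_in.
Qed.

Lemma ef_iso (M N : Type) (r : M -> M -> Prop) (s : N -> N -> Prop)
    (f : M -> N) q : bijective f -> (forall x y, r x y <-> s (f x) (f y)) ->
  ef_equiv r s q [set p | p.2 = f p.1].
Proof.
move=> [g fK gK] fr; elim: q => [|q IHq] /=.
  move=> [x y] [x' y'] /= -> ->; split; last exact: fr.
  by split=> [->|/(can_inj fK)].
split=> // [x|y]; first by exists (f x); apply: ef_sub IHq => p [|->].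
by exists (g y); apply: ef_sub IHq => p [|-> /=]; rewrite ?gK.
Qed.

Lemma ef_refl (M : Type) (r : M -> M -> Prop) q (Z : set (M * M)) :
  (forall p, Z p -> p.1 = p.2) -> ef_equiv r r q Z.
Proof.
move=> sZ; apply: ef_sub (@ef_iso _ _ r r id q _ _) => //; last by exists id.
by move=> p /sZ e; rewrite /= e.
Qed.

(** The easy half of the Ehrenfeucht-Fraisse theorem: [q] is the quantifier rank of [phi], each
    quantifier costing one round. *)
Lemma ef_sat (M N : Type) (r : M -> M -> Prop) (s : N -> N -> Prop) n
    (phi : formula n) : exists q, forall (e : n.-tuple M) (e' : n.-tuple N),
  ef_equiv r s q [set p | exists i, p = (tnth e i, tnth e' i)] ->
  sat r phi e <-> sat s phi e'.
Proof.
elim: phi => {n} [n i j|n i j|n|n phi [q Hq] psi [q' Hq']|n phi [q Hq]] /=.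
- exists 0 => e e' H.
  exact: (ef_atom H (ex_intro _ i erefl) (ex_intro _ j erefl)).1.
- exists 0 => e e' H.
  exact: (ef_atom H (ex_intro _ i erefl) (ex_intro _ j erefl)).2.
- by exists 0.
- exists (maxn q q') => e e' H.
  by rewrite (Hq e e' (ef_le (leq_maxl _ _) H)) (Hq' e e' (ef_le (leq_maxr _ _) H)).
- exists q.+1 => e e' [_ H1 H2].
  have sub x y : [set p | exists i, p = (tnth [tuple of x :: e] i,
      tnth [tuple of y :: e'] i)] `<=`
      [set p | exists i, p = (tnth e i, tnth e' i)] `|` [set (x, y)].
    move=> p [i ->]; case: (unliftP ord0 i) => [j|] ->.
      by rewrite !tnthS; left; exists j.
    by rewrite !tnth0; right.
  split=> H z.
    have [x Hx] := H2 z; apply/(Hq [tuple of x :: e]); last exact: H.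
    by apply: ef_sub Hx; apply: sub.
  have [y Hy] := H1 z; apply/(Hq _ [tuple of y :: e']); last exact: H.
  by apply: ef_sub Hy; apply: sub.
Qed.

Lemma ef_elementarily_equivalent (M N : Type) (r : M -> M -> Prop)
    (s : N -> N -> Prop) :
  (forall q, ef_equiv r s q set0) -> elementarily_equivalent r s.
Proof.
move=> H phi; have [q Hq] := ef_sat r s phi; apply: Hq.
by apply: ef_sub (H q) => p [[]].
Qed.

(** * Limits of sequences of finite conditions *)

(* The first [cdom] values of [cval], taken up to [ef_equiv] at rank [crank]. *)
Record condition (M : Type) := Condition {
  cval : nat -> M;
  cdom : nat;
  crank : nat
}.

Section GenericLimit.
Variables (M : Type) (r : M -> M -> Prop).

(** Old entries may move within their class of rank [crank c]. The last clause lets the entries of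
    [c'] answer every one-point challenge to [c], as Henkin witnesses would. *)
Definition cond_step (c c' : condition M) : Prop :=
  [/\ cdom c < cdom c', crank c < crank c' &
      forall x, exists2 l, l < cdom c' &
        ef_equiv r r (crank c)
          (matching (cdom c) (cval c) (cval c') `|` [set (x, cval c' l)])].

Variable c : nat -> condition M.
Hypothesis c_step : forall k, cond_step (c k) (c k.+1).

Let a k := cval (c k).
Let m k := cdom (c k).
Let q k := crank (c k).

Let m_le k k' : k <= k' -> m k <= m k'.
Proof.
apply: (@homo_leq _ m leq) => // [x y z|i]; first exact: leq_trans.
by case: (c_step i) => /ltnW.
Qed.

Let q_le k k' : k <= k' -> q k <= q k'.
Proof.
apply: (@homo_leq _ q leq) => // [x y z|i]; first exact: leq_trans.
by case: (c_step i) => _ /ltnW.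
Qed.

Let lt_m k : k < m k.+1.
Proof.
by elim: k => [|k IHk]; [case: (c_step 0) | case: (c_step k.+1)] => mS _ _;
  [apply: leq_ltn_trans mS | apply: leq_ltn_trans mS].
Qed.

Lemma leq_crank k : k <= q k.
Proof.
by elim: k => // k IHk; case: (c_step k) => _ qS _; apply: leq_ltn_trans qS.
Qed.

Lemma cond_coherent k k' :
  k <= k' -> ef_equiv r r (q k) (matching (m k) (a k) (a k')).
Proof.
move=> /subnK <-; elim: (k' - k) => [|j IHj].
  by apply: ef_refl => p [i _ ->].
(* The challenge [a k 0] is arbitrary; only the part about old entries is kept. *)
have [_ _ /(_ (a k 0))[l _ H]] := c_step (j + k).
apply: ef_trans IHj (ef_le (q_le (leq_addl j k)) H) => p [i im ->].
exists (a (j + k) i); first by exists i.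
by left; exists i => //; apply: leq_trans im (m_le (leq_addl _ _)).
Qed.

Let coh_atom k k' i j : i < m k -> j < m k -> i < m k' -> j < m k' ->
  (a k i = a k j <-> a k' i = a k' j) /\
  (r (a k i) (a k j) <-> r (a k' i) (a k' j)).
Proof.
wlog le_kk' : k k' / k <= k' => [W ik jk ik' jk'|].
  have [/W|/ltnW/W] := leqP k k'; first exact.
  by move=> [] // H1 H2; split; apply: iff_sym.
move=> ik jk _ _.
by apply: (ef_atom (cond_coherent le_kk') (ex_intro2 _ _ i ik erefl)
  (ex_intro2 _ _ j jk erefl)).
Qed.

(** The limit is a term model: indices modulo this relation. By coherence, any stage at which both
    indices are defined decides it. *)
Let sim i j := `[< exists k, [/\ i < m k, j < m k & a k i = a k j] >].

Let simE k i j : i < m k -> j < m k -> sim i j <-> a k i = a k j.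
Proof.
move=> ik jk; split=> [/asboolP[k' [ik' jk' e]]|e].
  by apply/(proj1 (coh_atom ik' jk' ik jk)).
by apply/asboolP; exists k.
Qed.

Let sim_equiv : equiv_class_of sim.
Proof.
pose K i j l := (maxn i (maxn j l)).+1.
have mK i j l : [/\ i < m (K i j l), j < m (K i j l) & l < m (K i j l)].
  by split; apply: leq_trans (lt_m _) (m_le _); rewrite ltnS !leq_max leqnn ?orbT.
split=> [i|i j|j i l].
- by have [im _ _] := mK i i i; apply/(simE im im).
- have [im jm _] := mK i j j.
  apply/idP/idP => [/(simE im jm) e|/(simE jm im) e].
    exact/(simE jm im).
  exact/(simE im jm).
- have [im jm lm] := mK i j l.
  move=> /(simE im jm) e /(simE jm lm) e'.
  by apply/(simE im lm); rewrite e.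
Qed.

Lemma generic_limit : exists (N : Type) (s : N -> N -> Prop) (f : nat -> N),
  [/\ countable [set: N], forall n, exists i, f i = n &
      forall k, ef_equiv s r (q k) (matching (m k) f (a k))].
Proof.
pose e := EquivRelPack sim_equiv.
pose N := {eq_quot e}; pose f (i : nat) : N := \pi_N i.
have fE k i j : i < m k -> j < m k -> f i = f j <-> a k i = a k j.
  by move=> ik jk; rewrite -(simE ik jk); split=> /(@eqmodP _ e).
pose s (u v : N) := exists k i j,
  [/\ i < m k, j < m k, u = f i, v = f j & r (a k i) (a k j)].
have sE k i j : i < m k -> j < m k -> s (f i) (f j) <-> r (a k i) (a k j).
  move=> ik jk; split=> [[k' [i' [j' [i'k' j'k' ei ej H]]]]|H]; last first.
    by exists k, i, j.
  pose K := maxn k k'.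
  have mk x : x < m k -> x < m K.
    by move=> H1; apply: leq_trans H1 (m_le (leq_maxl _ _)).
  have mk' x : x < m k' -> x < m K.
    by move=> H1; apply: leq_trans H1 (m_le (leq_maxr _ _)).
  apply/(proj2 (coh_atom ik jk (mk _ ik) (mk _ jk))).
  move/(fE K): ei => -> //; [|exact: mk|exact: mk'].
  move/(fE K): ej => -> //; [|exact: mk|exact: mk'].
  exact/(proj2 (coh_atom i'k' j'k' (mk' _ i'k') (mk' _ j'k'))).
have fsurj n : exists i, f i = n by exists (repr n); rewrite /f reprK.
exists N, s, f; split=> //.
  by apply/countable_injP; exists repr => x y _ _ xy; rewrite -[x]reprK xy reprK.
(* The rank [p] is freed from the stage, since the induction passes to later stages. *)
suff main p k : p <= q k -> ef_equiv s r p (matching (m k) f (a k)).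
  by move=> k; apply: main.
elim: p k => [k _|p IHp k pk].
  by move=> _ _ [i ik ->] [j jk ->] /=; split; [apply: fE | apply: sE].
split=> [|n|x]; first exact/IHp/ltnW.
(* An element of the limit is an index [l]: it is read at a later stage [j] and pulled back to stage
   [k] by coherence, at the cost of one rank. *)
- have [l <-] := fsurj n; pose j := maxn k l.+1.
  have kj : k <= j by apply: leq_maxl.
  have lj : l < m j by apply: leq_trans (lt_m l) (m_le (leq_maxr _ _)).
  have [_ _ /(_ (a j l))[y Hy]] := ef_le pk (cond_coherent kj).
  exists y; have Hf := IHp j (leq_trans (ltnW pk) (q_le kj)).
  have {}Hy := @ef_sym _ _ _ _ _ _ [set p | (matching (m k) (a k) (a j) `|`
    [set (y, a j l)]) (p.2, p.1)] (fun _ => id) Hy.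
  apply: ef_trans Hf Hy => _ [[i ik ->]|->] /=.
    exists (a j i); last by left; exists i.
    by exists i => //; apply: leq_trans ik (m_le kj).
  by exists (a j l); [exists l | right].
- have [mS _ /(_ x)[l lm /(ef_le (ltnW pk)) Hl]] := c_step k; exists (f l).
  have Hf := IHp k.+1 (leq_trans (ltnW pk) (q_le (leqnSn k))).
  have {}Hl := @ef_sym _ _ _ _ _ _ [set p | (matching (m k) (a k) (a k.+1) `|`
    [set (x, a k.+1 l)]) (p.2, p.1)] (fun _ => id) Hl.
  apply: ef_trans Hf Hl => _ [[i ik ->]|->] /=.
    exists (a k.+1 i); last by left; exists i.
    by exists i => //; apply: ltn_trans ik mS.
  by exists (a k.+1 l); [exists l | right].
Qed.

(** Categoricity enters here: ranks are unbounded, so the limit is elementarily equivalent to [M],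
    hence isomorphic to it, and what the conditions prescribe holds of an enumeration of [M]
    itself. *)
Lemma categorical_limit : aleph0_categorical r ->
  exists2 g : nat -> M, forall x, exists i, g i = x &
    forall k, ef_equiv r r (q k) (matching (m k) g (a k)).
Proof.
move=> cat; have [N [s [f [cN fsurj Hf]]]] := generic_limit.
have eqNM : elementarily_equivalent r s.
  apply: ef_elementarily_equivalent => p.
  apply: ef_sym (ef_le (leq_crank p) (Hf p)) => // p0 [].
have [h hbij hr] := cat N s cN eqNM.
have [h' hK h'K] := hbij.
exists (h' \o f) => [x|k].
  by have [i fi] := fsurj (h x); exists i; rewrite /= fi hK.
have Hh := ef_iso (q k) hbij hr.
apply: ef_trans Hh (Hf k) => _ [i ik ->] /=.
by exists (f i); [rewrite /= h'K | exists i].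
Qed.

End GenericLimit.

(** * Finite index and isolation of types *)

Definition append (M : Type) (a : nat -> M) (n : nat) (x : M) (i : nat) : M :=
  if i == n then x else a i.

Lemma matching_append (M N : Type) n (a : nat -> M) (b : nat -> N) x y :
  matching n.+1 (append a n x) (append b n y) = matching n a b `|` [set (x, y)].
Proof.
apply/seteqP; split=> p.
  case=> i; rewrite ltnS leq_eqVlt => /orP[/eqP->|ltin] ->.
    by right; rewrite /append eqxx.
  by left; exists i; rewrite // /append ltn_eqF.
case=> [[i ltin ->]|->]; last by exists n; rewrite // /append eqxx.
by exists i; [apply: ltnW | rewrite /append ltn_eqF].
Qed.

Section FinitelyManyTypes.
Variables (M : Type) (r : M -> M -> Prop).

(** Hintikka types: rank 0 records the atomic diagram; rank [q.+1] records the color of rank [q] and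
    those that occur among one-point extensions. *)
Lemma ef_finite_index q n : exists (F : finType) (t : (nat -> M) -> F),
  forall a b, t a = t b -> ef_equiv r r q (matching n a b).
Proof.
elim: q n => [|q IHq] n.
  exists ({ffun 'I_n * 'I_n -> bool * bool} : finType).
  exists (fun a => [ffun p => (`[< a (p.1 : 'I_n) = a (p.2 : 'I_n) >],
    `[< r (a (p.1 : 'I_n)) (a (p.2 : 'I_n)) >])]).
  move=> a b tab _ _ [i ltin ->] [j ltjn ->] /=.
  have /ffunP/(_ (Ordinal ltin, Ordinal ltjn)) := tab; rewrite !ffunE /=.
  by case=> e1 e2; split; apply: asbool_eq_equiv.
have [F [t Ht]] := IHq n.+1; have [F' [t' Ht']] := IHq n.
pose hit a : {ffun F -> bool} := [ffun y => `[< exists x, t (append a n x) = y >]].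
exists ({ffun F -> bool} * F')%type, (fun a => (hit a, t' a)).
have half a b x : hit a = hit b -> exists y, t (append a n x) = t (append b n y).
  move=> /ffunP/(_ (t (append a n x))); rewrite !ffunE => e.
  have [y <-] := proj1 (asbool_eq_equiv e) (ex_intro _ x erefl).
  by exists y.
move=> a b [e /Ht' H0]; split=> // [x|y].
  by have [y /Ht Hy] := half _ _ x e; exists y; rewrite -matching_append.
by have [x /esym/Ht Hx] := half _ _ y (esym e); exists x; rewrite -matching_append.
Qed.

Definition witnesses q m m' (a a' : nat -> M) : Prop :=
  (forall i, i < m -> a' i = a i) /\
  forall x, exists2 l, l < m' &
    ef_equiv r r q (matching m a a' `|` [set (x, a' l)]).

(** One entry per color of [m.+1]-tuples suffices, so [B] is the number of colors and does not
    depend on [a]. *)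
Lemma ef_witnesses (x0 : M) q m : exists2 B, 0 < B &
  forall a, exists a', witnesses q m (m + B) a a'.
Proof.
have [F [t Ht]] := ef_finite_index q m.+1.
exists #|F|; first by apply/card_gt0P; exists (t (fun=> x0)).
move=> a.
have /choice[w Hw] (y : F) :
    exists x, forall x', t (append a m x') = y -> t (append a m x) = y.
  have [[x Hx]|nex] := pselect (exists x, t (append a m x) = y).
    by exists x.
  by exists x0 => x' Hx'; case: nex; exists x'.
pose a' i := if i < m then a i else nth x0 [seq w y | y <- enum F] (i - m).
have a'E i : i < m -> a' i = a i by move=> ltim; rewrite /a' ltim.
exists a'; split=> // x; pose y := t (append a m x).
exists (m + index y (enum F)).
  by rewrite ltn_add2l cardE index_mem mem_enum.
have -> : a' (m + index y (enum F)) = w y.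
  rewrite /a' ltnNge leq_addr /= addKn (nth_map y) ?nth_index ?mem_enum //.
  by rewrite index_mem mem_enum.
have /esym/Ht := Hw y x erefl; rewrite matching_append; apply: ef_sub => p.
by case=> [[i ltim ->]|->]; [left; exists i; rewrite ?a'E | right].
Qed.

Lemma witnesses_step q m m' q' a a1 a' : m < m' -> q < q' ->
    witnesses q m m' a a1 -> ef_equiv r r q (matching m' a1 a') ->
  cond_step r (Condition a m q) (Condition a' m' q').
Proof.
move=> mm' qq' [_ Ha1] Ha'; split=> //= x; have [l lm' Hl] := Ha1 x.
exists l => //; apply: ef_trans Hl Ha' => p [[i im ->]|->] /=.
  by exists (a1 i); [left; exists i | exists i => //; apply: ltn_trans mm'].
by exists (a1 l); [right | exists l].
Qed.

Hypotheses (x0 : M) (cat : aleph0_categorical r).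

Lemma generic_enumeration (P : nat -> condition M -> Prop) (c0 : condition M) :
    P 0 c0 ->
    (forall k c, P k c -> exists2 c', P k.+1 c' & cond_step r c c') ->
  exists2 g : nat -> M, forall x, exists i, g i = x &
    forall k, exists c, [/\ P k c, k <= crank c &
      ef_equiv r r (crank c) (matching (cdom c) g (cval c))].
Proof.
move=> P0 PS; have [c _ cP] := dependent_choice_inv PS P0.
have cS k : cond_step r (c k) (c k.+1) by case: (cP k).
have [g gsurj Hg] := categorical_limit cS cat.
exists g => // k; exists (c k); split=> //; first by case: (cP k).
exact: (leq_crank cS k).
Qed.

(* The type of c is not isolated at rank q. *)
Definition splits n q (c : nat -> M) : Prop :=
  exists2 d, ef_equiv r r q (matching n d c) &
    exists q', ~ ef_equiv r r q' (matching n d c).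

Lemma splits_le n q q' c : q <= q' -> splits n q' c -> splits n q c.
Proof. by move=> le [d Hd Hn]; exists d => //; apply: ef_le Hd. Qed.

Lemma matching_sym q n (a b : nat -> M) :
  ef_equiv r r q (matching n a b) -> ef_equiv r r q (matching n b a).
Proof. by apply: ef_sym => _ [i im ->]; exists i. Qed.

Lemma matching_trans q n (a b c : nat -> M) : ef_equiv r r q (matching n a b) ->
  ef_equiv r r q (matching n b c) -> ef_equiv r r q (matching n a c).
Proof. by apply: ef_trans => _ [i im ->]; exists (b i); exists i. Qed.

Lemma splits_ef n q c c' :
  ef_equiv r r q (matching n c c') -> splits n q c -> splits n q c'.
Proof.
move=> Hcc' [d Hd [q' nq']].
have [Hd'|] := pselect (forall p, ef_equiv r r p (matching n c c')); last first.
  by move=> /existsNP[p np]; exists c => //; exists p.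
exists d; first exact: matching_trans Hd Hcc'.
by exists q' => H; apply: nq'; apply: matching_trans H (matching_sym (Hd' q')).
Qed.

(** Omitting types: if [c] split at every rank, some enumeration of [M] would avoid its type at
    every [n]-tuple of indices, although the entries of [c] are themselves enumerated. *)
Lemma not_splits n c : exists q, ~ splits n q c.
Proof.
apply/existsNP => c_splits.
(* Stage k makes the entries indexed by the k-th sequence omit the type of c;
   [CodeSeq.decode k] has all its terms below k, so they are in the domain. *)
pose handled j (s : condition M) := size (CodeSeq.decode j) = n ->
  ~ ef_equiv r r (crank s)
      (matching n (fun i => cval s (nth 0 (CodeSeq.decode j) i)) c).
pose P k (s : condition M) := k <= cdom s /\ if k is j.+1 then handled j s else True.
have step k s : P k s -> exists2 s', P k.+1 s' & cond_step r s s'.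
  case: s => a m q [/= km _]; pose v := CodeSeq.decode k.
  have [B B0 /(_ a)[a1 Ha1]] := ef_witnesses x0 q m; set m' := m + B in Ha1.
  have mm' : m < m' by rewrite -[m]addn0 ltn_add2l.
  have km' : k < m' by apply: leq_ltn_trans mm'.
  have [szv|szv] := eqVneq (size v) n; last first.
    exists (Condition a1 m' q.+1); first by split=> // /eqP e; rewrite e in szv.
    by apply: witnesses_step Ha1 _ => //; apply: ef_refl => p [i _ ->].
  have vm' i : i < n -> nth 0 v i < m'.
    rewrite -szv => iv; apply: ltn_trans km'.
    have /allP := CodeSeq.ltn_code v; rewrite CodeSeq.decodeK; apply.
    exact: mem_nth.
  have [Hc|] := pselect
      (forall p, ef_equiv r r p (matching n (fun i => a1 (nth 0 v i)) c)); last first.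
    move=> /existsNP[p np]; exists (Condition a1 m' (maxn p q.+1)).
      by split=> // _ /(ef_le (leq_maxl p q.+1)).
    apply: witnesses_step Ha1 _ => //; first by rewrite leq_max leqnn orbT.
    by apply: ef_refl => p' [i _ ->].
  (* The [m'] extra ranks pay for moving all [m'] entries along with the passage from [c] to [d], so
     that agreement at rank [q] survives. *)
  have [d Hd [p np]] := c_splits (q + m').
  have [b Hb] := ef_extend a1 (inhabits x0)
    (matching_trans (Hc _) (matching_sym Hd)).
  have bd i : i < n -> b (nth 0 v i) = d i.
    move=> ltin; apply/esym.
    have /= H := ef_atom Hb (or_introl (ex_intro2 _ _ i ltin erefl))
      (or_intror (ex_intro2 _ _ (nth 0 v i) (vm' i ltin) erefl)).
    exact/(proj1 H).
  exists (Condition b m' (maxn p q.+1)).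
    split=> // _ /(ef_le (leq_maxl p q.+1)) H; apply: np; apply: ef_sub H.
    by move=> _ [i ltin ->]; exists i; rewrite // -bd.
  apply: witnesses_step Ha1 _ => //; first by rewrite leq_max leqnn orbT.
  by apply: ef_sub Hb => p'; right.
have P0 : P 0 (Condition (fun=> x0) 0 0) by [].
have [g gsurj Hg] := generic_enumeration P0 step.
have [w Hw] := choice gsurj.
pose v := mkseq (fun i => w (c i)) n; pose k := CodeSeq.code v.
have [s [[ks hs] _ Hs]] := Hg k.+1.
have szv : size (CodeSeq.decode k) = n by rewrite CodeSeq.codeK size_mkseq.
case: (hs szv); rewrite CodeSeq.codeK.
apply: ef_sym Hs => _ [i ltin ->] /=; exists (nth 0 v i); last first.
  by rewrite nth_mkseq // Hw.
have /allP/(_ (nth 0 v i)) := CodeSeq.ltn_code v.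
rewrite mem_nth ?size_mkseq // => /(_ isT) lt; exact: ltn_trans lt ks.
Qed.

(* The rank-q class of c contains tuples whose types are isolated only at
   arbitrarily high ranks, or not at all: an infinite subtree in Koenig's
   lemma. *)
Definition splits_near n q (c : nat -> M) : Prop :=
  forall k, exists2 c', ef_equiv r r q (matching n c c') & splits n k c'.

(** Pigeonhole on the finitely many colors of rank [q]: if each color had its own bound on [k],
    their maximum would bound all of [D]. *)
Lemma splits_near_exists n (D : set (nat -> M)) :
    (forall k, exists2 c, D c & splits n k c) ->
  forall q, exists2 c, D c & splits_near n q c.
Proof.
move=> Dsplits q; have [F [t Ht]] := ef_finite_index q n.
have [[y Hy]|/forallNP noy] :=
    pselect (exists y, forall k, exists2 c, D c /\ t c = y & splits n k c).
  have [c [Dc tc] _] := Hy 0; exists c => // k.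
  have [c' [Dc' tc'] Hc'] := Hy k; exists c' => //.
  by apply: Ht; rewrite tc tc'.
have /choice[K HK] (y : F) :
    exists k, ~ exists2 c, D c /\ t c = y & splits n k c.
  exact/existsNP.
have [c Dc /(splits_le (leq_bigmax (t c))) Hc] := Dsplits (\max_y K y).
by case: (HK (t c)); exists c.
Qed.

(** Koenig's argument inside the construction of conditions: the first [n] entries stay near
    splitting tuples at growing ranks, so in the limit their type splits at every rank. *)
Lemma uniform_not_splits n : exists q, forall c, ~ splits n q c.
Proof.
apply: contrapT => /forallNP nq.
have all_splits k : exists2 c, setT c & splits n k c.
  by have /existsNP[c /contrapT] := nq k; exists c.
(* [B] must not depend on the sequence, since the invariant mentions it before the entries have
   moved. *)
have /choice[B HB] (p : nat * nat) : exists B, 0 < B /\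
    forall a, exists a', witnesses p.1 p.2 (p.2 + B) a a'.
  by have [B] := ef_witnesses x0 p.1 p.2; exists B.
(* The invariant leaves room for moving the first [n] entries after witnesses
   have been added. *)
pose P (k : nat) (s : condition M) := n <= cdom s /\
  splits_near n (crank s + (cdom s + B (crank s, cdom s))) (cval s).
have step k s : P k s -> exists2 s', P k.+1 s' & cond_step r s s'.
  case: s => a m q [/= nm near_a]; have [B0 /(_ a)[a1 Ha1]] := HB (q, m).
  rewrite /= in B0 Ha1; set m' := m + B (q, m) in near_a Ha1.
  have mm' : m < m' by rewrite -[m]addn0 ltn_add2l.
  have [c Hc near_c] := splits_near_exists near_a (q.+1 + (m' + B (q.+1, m'))).
  have [b Hb] := ef_extend a1 (inhabits x0) Hc.
  have bc i : i < n -> b i = c i.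
    move=> ltin; have ltim := leq_trans ltin nm; apply/esym.
    have /= H := ef_atom Hb (or_introl (ex_intro2 _ _ i ltin erefl))
      (or_intror (ex_intro2 _ _ i (ltn_trans ltim mm') erefl)).
    by apply/(proj1 H); rewrite Ha1.1.
  exists (Condition b m' q.+1).
    split=> [|k']; first exact: leq_trans nm (ltnW mm').
    have [c' Hc' sc'] := near_c k'; exists c' => //; apply: ef_sub Hc'.
    by move=> _ [i ltin ->]; exists i; rewrite //= bc.
  by apply: witnesses_step Ha1 _ => //; apply: ef_sub Hb => p; right.
have [c _ Hc] := splits_near_exists all_splits (0 + (n + B (0, n))).
have P0 : P 0 (Condition c n 0) by [].
have [g _ Hg] := generic_enumeration P0 step.
(* Here [q] is a rank at which the first [n] terms of [g] do not split, while stage [q] has rank at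
   least [q] and a nearby tuple splitting at rank [q]. *)
have [q] := not_splits n g; case; have [s [[ns near_s] qs Hs]] := Hg q.
have [c' Hc' sc'] := near_s q; apply: splits_ef sc'; apply: matching_sym.
apply: matching_trans (ef_le _ Hc'); last exact: leq_trans qs (leq_addr _ _).
apply: ef_sub (ef_le qs Hs) => _ [i ltin ->].
by exists i => //; apply: leq_trans ns.
Qed.

(** * Automorphisms and orbits of pairs *)

Definition same_type n (a b : nat -> M) : Prop :=
  forall q, ef_equiv r r q (matching n a b).

Lemma same_type_sym n a b : same_type n a b -> same_type n b a.
Proof. by move=> H q; apply: matching_sym. Qed.

(** With a uniform isolating rank [q] for [n.+1]-tuples, one answer correct at rank [q] is correct
    at all ranks. *)
Lemma same_type_forth n a b x : same_type n a b ->
  exists y, same_type n.+1 (append a n x) (append b n y).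
Proof.
move=> Hab; have [q Hq] := uniform_not_splits n.+1.
have [_ /(_ x)[y Hy] _] := Hab q.+1; exists y => q'.
apply: contrapT => nHy; apply: (Hq (append b n y)).
by exists (append a n x); [rewrite matching_append | exists q'].
Qed.

Lemma same_type_back n a b y : same_type n a b ->
  exists x, same_type n.+1 (append a n x) (append b n y).
Proof.
move=> /same_type_sym/(same_type_forth y)[x /same_type_sym Hx].
by exists x.
Qed.

(** Cantor's back-and-forth: stage [j.+1] puts the [j]-th point of an enumeration into domain and
    range. *)
Lemma same_type_automorphism n a b :
    countable [set: M] -> same_type n a b ->
  exists f : M -> M, [/\ bijective f, forall x y, r x y <-> r (f x) (f y)
    & forall i, i < n -> f (a i) = b i].
Proof.
move=> cM Hab; have [e e_surj] := countable_enum x0 cM.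
pose finite_type Z := exists n a b, Z = matching n a b /\ same_type n a b.
pose P k Z := finite_type Z /\
  if k is j.+1 then (exists y, Z (e j, y)) /\ (exists x, Z (x, e j)) else True.
have step k Z : P k Z -> exists2 Z', P k.+1 Z' & Z `<=` Z'.
  case=> [[m [a1 [b1 [-> H1]]]] _].
  have [y Hy] := same_type_forth (e k) H1.
  have [x Hx] := same_type_back (e k) Hy.
  exists (matching m a1 b1 `|` [set (e k, y)] `|` [set (x, e k)]); last first.
    by move=> p Zp; left; left.
  split; last by split; [exists y; left; right | exists x; right].
  by rewrite -!matching_append; do 3 eexists; split; last exact: Hx.
have P0 : P 0 (matching n a b) by split=> //; exists n, a, b.
have [Z Z0 HZ] := dependent_choice_inv step P0.
have Z_le k k' : k <= k' -> Z k `<=` Z k'.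
  apply: (@homo_leq _ Z (fun A B => A `<=` B)) => [A|A B C|i].
  - exact: subset_refl.
  - exact: subset_trans.
  - by case: (HZ i).
have atom k k' p p' : Z k p -> Z k' p' ->
    (p.1 = p'.1 <-> p.2 = p'.2) /\ (r p.1 p'.1 <-> r p.2 p'.2).
  move=> /(Z_le _ _ (leq_maxl k k')) Zp /(Z_le _ _ (leq_maxr k k')) Zp'.
  have [[[m [a1 [b1 [EZ H1]]]] _] _] := HZ (maxn k k').
  by apply: (ef_atom (H1 0)); rewrite -EZ.
have /choice[f Hf] x : exists y, exists k, Z k (x, y).
  have [i <-] := e_surj x; have [[_ [[y Zy] _]] _] := HZ i.+1.
  by exists y, i.+1.
have /choice[g Hg] y : exists x, exists k, Z k (x, y).
  have [i <-] := e_surj y; have [[_ [_ [x Zx]]] _] := HZ i.+1.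
  by exists x, i.+1.
exists f; split.
- exists g => [x|y].
    have [k Zk] := Hg (f x); have [k' Zk'] := Hf x.
    exact: (proj2 (proj1 (atom _ _ _ _ Zk Zk'))).
  have [k Zk] := Hg y; have [k' Zk'] := Hf (g y).
  exact: (proj1 (proj1 (atom _ _ _ _ Zk' Zk))).
- move=> x y; have [k Zk] := Hf x; have [k' Zk'] := Hf y.
  exact: (proj2 (atom _ _ _ _ Zk Zk')).
- move=> i ltin; have [k Zk] := Hf (a i).
  have Zi : Z 0 (a i, b i) by rewrite Z0; exists i.
  exact: (proj1 (proj1 (atom _ _ _ _ Zk Zi))).
Qed.

Lemma finitely_many_pair_orbits : countable [set: M] ->
  exists (F : finType) (t : M -> M -> F), forall x y x' y',
  t x y = t x' y' -> exists f : M -> M, [/\ bijective f,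
    forall u v, r u v <-> r (f u) (f v), f x = x' & f y = y'].
Proof.
move=> cM; have [q Hq] := uniform_not_splits 2.
have [F [t Ht]] := ef_finite_index q 2.
pose pair (x y : M) i := if i == 0 then x else y.
exists F, (fun x y => t (pair x y)) => x y x' y' /Ht H.
have Hxy : same_type 2 (pair x y) (pair x' y').
  move=> q'; apply: contrapT => nH; apply: (Hq (pair x' y')).
  by exists (pair x y); last exists q'.
have [f [f_bij fr Hf]] := same_type_automorphism cM Hxy.
by exists f; split=> //; [apply: (Hf 0) | apply: (Hf 1)].
Qed.

End FinitelyManyTypes.

(** * Maximal chains and their order types *)

Lemma ultrafilter_finite_color (T : Type) (F : finType) (G : set_system T)
    (h : T -> F) : UltraFilter G -> exists t, G [set x | h x = t].
Proof.
move=> GU; apply: contrapT => /forallNP noG.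
have Gn t : G [set x | h x <> t].
  by have [/noG|] := in_ultra_setVsetC [set x | h x = t] GU.
have [x /(_ (h x))] : exists x, forall t, h x <> t.
  by apply: (@filter_ex _ G); apply: filter_forall.
by apply.
Qed.

Section MaximalChains.
Context {d : Order.disp_t} {T : porderType d}.
Implicit Types (C D : set T) (x y z : T).
Local Open Scope order_scope.
Import Order.TTheory.

Definition order_automorphism (f : T -> T) : Prop :=
  bijective f /\ forall x y, x <= y <-> f x <= f y.

Lemma order_automorphism_lt f x y : order_automorphism f -> x < y -> f x < f y.
Proof.
case=> f_bij fr; rewrite !lt_neqAle => /andP[xy /fr ->]; rewrite andbT.
by apply: contra xy => /eqP/(bij_inj f_bij) ->.
Qed.

Lemma mem_maximal_chain C x :
  maximal_chain C -> (forall y, C y -> x <= y \/ y <= x) -> C x.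
Proof.
move=> [Cchain Cmax] Cx; rewrite -(Cmax (C `|` [set x])); first by right.
  move=> y z [Cy|->] [Cz|->]; [exact: Cchain | | exact: Cx | by left].
  by case: (Cx y Cy); [right | left].
by move=> y; left.
Qed.

Lemma order_isomorphic_of_lt C D (f : T -> T) : chain C ->
    (forall x, C x -> D (f x)) -> (forall x y, C x -> C y -> x < y -> f x < f y) ->
    (forall y, D y -> exists2 x, C x & f x = y) ->
  order_isomorphic C D.
Proof.
move=> Cchain fCD f_lt f_surj.
have f_le x y : C x -> C y -> x <= y -> f x <= f y.
  move=> Cx Cy; rewrite le_eqVlt => /orP[/eqP->//|xy].
  exact/ltW/f_lt.
have f_le' x y : C x -> C y -> f x <= f y -> x <= y.
  move=> Cx Cy fxy; have [//|] := Cchain x y Cx Cy.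
  rewrite le_eqVlt => /orP[/eqP->//|/(f_lt _ _ Cy Cx)].
  by move=> /lt_le_trans/(_ fxy); rewrite ltxx.
exists f => [|x y Cx Cy]; last by split; [apply: f_le | apply: f_le'].
split=> [//|x y /set_mem Cx /set_mem Cy e|y /f_surj[x Cx <-]]; last by exists x.
by apply: le_anti; rewrite (f_le' x y) ?(f_le' y x) // e.
Qed.

Hypothesis tree_le : forall x y z, x <= z -> y <= z -> x <= y \/ y <= x.

(** Such a [y] is comparable with the elements of [C] below [x] by the tree axiom and with those
    above by transitivity. *)
Lemma maximal_chain_closed C x y : maximal_chain C -> C x -> y <= x -> C y.
Proof.
move=> CM Cx yx; apply: mem_maximal_chain => // z Cz.
have [zx|xz] := CM.1 z x Cz Cx; first exact: tree_le yx zx.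
by left; apply: le_trans xz.
Qed.

Lemma maximal_chain_iso_max C D m m' f :
    maximal_chain C -> maximal_chain D -> order_automorphism f -> f m = m' ->
    C m -> (forall x, C x -> x <= m) -> D m' -> (forall x, D x -> x <= m') ->
  order_isomorphic C D.
Proof.
move=> CM DM Hf <- Cm maxm Dm' maxm'; have [[g fK gK] fr] := Hf.
apply: (@order_isomorphic_of_lt C D f CM.1) => [x Cx|x y _ _|y Dy].
- by apply: (maximal_chain_closed DM Dm'); apply: (proj1 (fr _ _)); apply: maxm.
- exact: order_automorphism_lt.
- exists (g y) => //; apply: (maximal_chain_closed CM Cm).
  by apply: (proj2 (fr _ _)); rewrite gK; apply: maxm'.
Qed.

Definition ladder C (x : nat -> T) : Prop :=
  [/\ forall i, C (x i), forall i, x i < x i.+1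
    & forall y, C y -> exists i, y <= x i].

Lemma ladder_le C (x : nat -> T) i j : ladder C x -> (i <= j)%N -> x i <= x j.
Proof.
case=> _ xS _; apply: (@homo_leq _ x (fun u v => u <= v)) => [u|u v w|k].
- exact: lexx.
- exact: le_trans.
- exact: ltW.
Qed.

(** The chain is cut into blocks, block [k] running from [x k], excluded, to [x k.+1]; block 0 also
    takes everything up to [x 0], hence no lower bound there. *)
Lemma ladder_rank C (x : nat -> T) : chain C -> ladder C x ->
  exists rk : T -> nat, forall z, C z ->
    [/\ z <= x (rk z).+1, forall j, z <= x j.+1 -> (rk z <= j)%N
      & (0 < rk z)%N -> x (rk z) < z].
Proof.
move=> Cchain Lx; have [Cx xS x_cof] := Lx.
suff /choice[rk Hrk] z : exists k, C z -> [/\ z <= x k.+1,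
    forall j, z <= x j.+1 -> (k <= j)%N & (0 < k)%N -> x k < z] by exists rk.
have [Cz|nCz] := pselect (C z); last by exists 0%N.
have exk : exists k, z <= x k.+1.
  have [i zi] := x_cof z Cz; exists i; apply: le_trans zi _.
  exact: ladder_le Lx (leqnSn i).
exists (ex_minn exk) => _; case: ex_minnP => k zk kmin; split=> //.
case: k zk kmin => // k zk kmin _.
have nzk : ~ z <= x k.+1 by move=> /kmin; rewrite ltnn.
have [//|] := Cchain _ _ Cz (Cx k.+1).
by rewrite le_eqVlt => /orP[/eqP e|//]; case: nzk; rewrite e.
Qed.

(** Each [f i] is used on block [i] only; the pieces fit because [f i] respects both ends of the
    block. *)
Lemma maximal_chain_iso_ladder C D (x y : nat -> T) (f : nat -> T -> T) :
    maximal_chain C -> maximal_chain D -> ladder C x -> ladder D y ->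
    (forall i, [/\ order_automorphism (f i), f i (x i) = y i &
                   f i (x i.+1) = y i.+1]) ->
  order_isomorphic C D.
Proof.
move=> CM DM Lx Ly Hf; have [Cx _ _] := Lx; have [Dy _ _] := Ly.
have [rk Hrk] := ladder_rank CM.1 Lx; have [rk' Hrk'] := ladder_rank DM.1 Ly.
apply: (@order_isomorphic_of_lt C D (fun z => f (rk z) z) CM.1) => [z|z w|u].
- move=> /Hrk[zx _ _]; apply: (maximal_chain_closed DM (Dy (rk z).+1)).
  by have [[_ fr] _ <-] := Hf (rk z); apply: (proj1 (fr _ _)).
- move=> Cz Cw zw; have [zx z_min _] := Hrk z Cz; have [wx _ w_gt] := Hrk w Cw.
  have := z_min _ (le_trans (ltW zw) wx).
  rewrite leq_eqVlt => /orP[/eqP->|rk_lt].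
    by apply: order_automorphism_lt zw; have [] := Hf (rk w).
  (* For points of different blocks, the rung [y (rk w)] separates the images. *)
  have [[_ fr] _ fzS] := Hf (rk z); have [fw_aut fw _] := Hf (rk w).
  have fz : f (rk z) z <= y (rk z).+1 by rewrite -fzS; apply: (proj1 (fr _ _)).
  apply: (le_lt_trans (le_trans fz (ladder_le Ly rk_lt))).
  rewrite -fw; apply: order_automorphism_lt fw_aut _.
  exact: w_gt (leq_ltn_trans (leq0n _) rk_lt).
(* The automorphism of the block of [u] pulls [u] back; a preimage of lower rank would force
   [u <= y i]. *)
- move=> Du; have [uy u_min u_gt] := Hrk' u Du; set i := rk' u in uy u_min u_gt.
  have [[[g fK gK] fr] fi fiS] := Hf i; pose z := g u.
  have zx : z <= x i.+1 by apply: (proj2 (fr _ _)); rewrite gK fiS.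
  have Cz : C z by apply: maximal_chain_closed CM (Cx _) zx.
  exists z => //; suff -> : rk z = i by rewrite gK.
  have [zx' z_min _] := Hrk z Cz; apply/eqP; rewrite eqn_leq z_min //= leqNgt.
  apply/negP => rk_lt; have : u <= y i.
    rewrite -[u]gK -fi; apply: (proj1 (fr _ _)); apply: le_trans zx' _.
    exact: ladder_le Lx rk_lt.
  by move=> /(lt_le_trans (u_gt (leq_ltn_trans (leq0n _) rk_lt))); rewrite ltxx.
Qed.

(* For an ultrafilter G containing the final segments of C, let c x be the color
   of (x, y) for G-almost all y, and k the value of c at G-almost all points;
   from x with c x = k one can then always climb to a y with c y = k along an
   edge of color k. *)
Lemma ladder_homogeneous C (F : finType) (t : T -> T -> F) x0 :
    countable [set: T] -> chain C -> C x0 ->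
    (forall x, C x -> exists2 y, C y & ~ y <= x) ->
  exists2 x : nat -> T, ladder C x & exists k, forall i, t (x i) (x i.+1) = k.
Proof.
move=> cT Cchain Cx0 nomax; have [e e_surj] := countable_enum x0 cT.
pose F0 : set_system T :=
  [set A | exists2 x, C x & forall y, C y -> x < y -> A y].
have C_lt x y : C x -> C y -> ~ y <= x -> x < y.
  move=> Cx Cy nyx; have [|//] := Cchain x y Cx Cy.
  by rewrite le_eqVlt => /orP[/eqP e1|//]; case: nyx; rewrite e1.
have F0_proper : ProperFilter F0.
  split=> [[x Cx Hx]|].
    by have [y Cy /(C_lt _ _ Cx Cy)] := nomax x Cx; apply: Hx.
  split=> [|A B [x Cx Ax] [y Cy By]|A B AB [x Cx Ax]].
  - by exists x0.
  - have [xy|yx] := Cchain x y Cx Cy.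
      exists y => // z Cz yz; split; last exact: By.
      by apply: Ax => //; apply: le_lt_trans yz.
    exists x => // z Cz xz; split; first exact: Ax.
    by apply: By => //; apply: le_lt_trans xz.
  - by exists x => // y Cy /(Ax y Cy)/AB.
have [G [GU F0G]] := ultraFilterLemma F0_proper.
have /choice[c Hc] x := ultrafilter_finite_color (t x) GU.
have [k Hk] := ultrafilter_finite_color c GU.
have G_gt x : C x -> G [set y | C y /\ x < y] by move=> Cx; apply: F0G; exists x.
(* The last clause makes the sequence cofinal: stage [j.+1] dominates the [j]-th point of the
   enumeration if it lies in [C]. *)
pose P (n : nat) x := [/\ C x, c x = k &
  if n is j.+1 then C (e j) -> e j <= x else True].
have step n x : P n x -> exists2 y, P n.+1 y & x < y /\ t x y = k.
  case=> Cx cx _.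
  have Ge : G [set y | C (e n) -> e n <= y].
    have [Cen|nCen] := pselect (C (e n)); last by apply: filterE => y /nCen.
    by apply: filterS (G_gt _ Cen) => y [_ /ltW eny] _.
  have [y [[[[Cy xy] ey] cy] txy]] :=
    filter_ex (filterI (filterI (filterI (G_gt x Cx) Ge) Hk) (Hc x)).
  by exists y; split=> //; rewrite txy.
have [x1 [[Cx1 _] cx1]] := filter_ex (filterI (G_gt x0 Cx0) Hk).
have P0 : P 0%N x1 by [].
have [x _ Hx] := dependent_choice_inv step P0.
exists x; last by exists k => i; case: (Hx i) => _ [].
split=> [i|i|y Cy]; first by case: (Hx i) => [[]].
  by case: (Hx i) => _ [].
have [j ej] := e_surj y; exists j.+1; have [[_ _ +] _] := Hx j.+1.
by rewrite ej; apply.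
Qed.

End MaximalChains.

Theorem theorem2p11 (d : Order.disp_t) (T : porderType d)
    (hcount : countable [set: T]) (htree : is_tree T)
    (hcat : aleph0_categorical (fun x y : T => (x <= y)%O)) :
  exists F : set (set T),
    [/\ finite_set F,
        F `<=` @maximal_chain d T
      & forall C : set T, maximal_chain C ->
          exists2 D : set T, F D & order_isomorphic C D].
Proof.
(* Codes form a relation, not a function: a chain may have many ladders, of different colors. *)
suff [F [code [code_ex code_iso]]] : exists (F : finType)
    (code : set T -> F -> Prop),
    (forall C, maximal_chain C -> exists k, code C k) /\
    (forall C D k, maximal_chain C -> maximal_chain D -> code C k -> code D k ->
      order_isomorphic C D).
  have /choice[R HR] (k : F) : exists D, forall C, maximal_chain C -> code C k ->
      maximal_chain D /\ code D k.
    have [[D HD]|nD] := pselect (exists D, maximal_chain D /\ code D k).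
      by exists D.
    (* The value [set0] is a dummy for codes that no maximal chain bears; the image below discards
       them. *)
    by exists set0 => C HC Ck; case: nD; exists C.
  exists (R @` [set k | maximal_chain (R k) /\ code (R k) k]); split.
  - exact: finite_image.
  - by move=> _ [k [Rk _] <-].
  - move=> C HC; have [k Ck] := code_ex C HC; have [Rk Rkk] := HR k C HC Ck.
    by exists (R k); [exists k | apply: code_iso Ck Rkk].
have [[x0 _]|T0] := pselect (exists x0 : T, True); last first.
  exists unit, (fun _ _ => True); split=> [C _|C D _ _ _ _ _]; first by exists tt.
  exists id => [|x]; last by case: T0; exists x.
  by split=> [x|x|x]; case: T0; exists x.
have [F [t Ht]] := finitely_many_pair_orbits x0 hcat hcount.
(* Left codes are colors of [(m, m)] for a greatest element [m]; right codes are the constant color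
   of consecutive rungs. *)
exists (F + F)%type, (fun C k => match k with
  | inl k => exists m, [/\ C m, forall y, C y -> (y <= m)%O & t m m = k]
  | inr k => exists2 x : nat -> T, ladder C x & forall i, t (x i) (x i.+1) = k
  end); split=> [C HC|C D [k|k] HC HD].
- have [[m [Cm maxm]]|nomax] :=
      pselect (exists m, C m /\ forall y, C y -> (y <= m)%O).
    by exists (inl (t m m)), m.
  have [y Cy] : exists y, C y.
    apply: contrapT => /forallNP nC; apply: (nC x0).
    by apply: mem_maximal_chain HC _ => y /nC.
  have [|x Lx [k Hk]] := ladder_homogeneous t hcount HC.1 Cy; last first.
    by exists (inr k), x.
  move=> x Cx; apply: contrapT => nx; apply: nomax; exists x; split=> // z Cz.
  by apply: contrapT => nzx; apply: nx; exists z.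
- move=> [m [Cm maxm tm]] [m' [Dm' maxm' tm']].
  have [f [f_bij fr fm _]] := Ht m m m' m' (etrans tm (esym tm')).
  exact: (maximal_chain_iso_max htree.1 HC HD (conj f_bij fr) fm).
- move=> [x Lx tx] [y Ly ty].
  have /choice[f Hf] i := Ht _ _ _ _ (etrans (tx i) (esym (ty i))).
  apply: (maximal_chain_iso_ladder htree.1 HC HD Lx Ly (f := f)) => i.
  by have [f_bij fr fx fxS] := Hf i; split.
Qed.
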